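(* Let $(V,0)=(\{f_1=\dots=f_q=0\},0)\subset(\mathbb{C}^n,0)$ be an isolated complete intersection singularity of dimension $n-q$, and let $X=\sum_{i=1}^n X_i\frac{\partial}{\partial z_i}$ be the germ of a holomorphic vector field on $(\mathbb{C}^n,0)$ tangent to $V$, say $Xf=Cf$ with $C$ a $q\times q$ matrix over $\mathcal{O}_{\mathbb{C}^n,0}$, with an isolated zero on $V$. If all coefficients of the matrix $C$ are contained in the ideal of $\mathcal{O}_{\mathbb{C}^n,0}$ generated by the maximal ($q\times q$) minors of the Jacobian matrix of $f=(f_1,\dots,f_q)$, then $X$ is a good vector field with respect to $V$.
   Context: $\mathcal{O}_{\mathbb{C}^n,0}$ is the ring of germs of holomorphic functions at $0\in\mathbb{C}^n$. $Xf=(Xf_1,\dots,Xf_q)^t$. Good vector field: $X$ is good (with respect to $V$) if there is a holomorphic deformation $X_t$ of $X$ (a family of vector fields depending holomorphically on $(z,t)$ near $(0,0)\in\mathbb{C}^n\times\mathbb{C}^q$, with $X_0=X$) such that for all $t\in\mathbb{C}^q$ sufficiently close to $0$ the vector field $X_t$ is tangent to the fibre $V_t=f^{-1}(t)$. *)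

(* Defs.v *)
(* Germs at a point of C^n are represented by total functions; only their values
   near that point matter, and germ identities are stated with [\forall _ \near _]. *)
From HB Require Import structures.
From mathcomp Require Import all_boot all_order all_algebra.
From mathcomp Require Import complex.
From mathcomp Require Import all_classical all_reals all_analysis.
From mathcomp.analysis.showcase Require summability.

Set Implicit Arguments.
Unset Strict Implicit.
Unset Printing Implicit Defensive.

Import Order.TTheory GRing.Theory Num.Theory numFieldNormedType.Exports.

Local Open Scope ring_scope.
Local Open Scope classical_set_scope.
Local Open Scope complex_scope.

(* R[i] packed as a structure, so that its norm topology is inferred. *)
Definition CC (R : realType) : numClosedFieldType := R[i].

Section Holomorphic.
Context {R : realType}.
Local Notation C := (CC R).

Definition multi_power n (h : 'cV[C]_n) (al : {ffun 'I_n -> nat}) : C :=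
  \prod_(i < n) h i 0 ^+ al i.

(* f z is the sum of a convergent power series in z - p for all z near p.
   Convergence of a multiple series means summability over the multi-indices,
   i.e. along the directed set of their finite subsets. *)
Definition power_series_at n (p : 'cV[C]_n) (f : 'cV[C]_n -> C) : Prop :=
  exists a : {ffun 'I_n -> nat} -> C, \forall z \near p,
    summability.partial_sum (fun al => a al * multi_power (z - p) al)
      @ summability.totally --> f z.

(* Weierstrass's definition of holomorphy on a neighbourhood of p. *)
Definition holomorphic_at n (p : 'cV[C]_n) (f : 'cV[C]_n -> C) : Prop :=
  \forall w \near p, power_series_at w f.

Definition holomorphic_mx_at n (p : 'cV[C]_n) k l
    (A : 'cV[C]_n -> 'M[C]_(k, l)) : Prop :=
  forall i j, holomorphic_at p (fun z => A z i j).

Definition jacobian_mx n q (f : 'cV[C]_n -> 'cV[C]_q) (z : 'cV[C]_n) :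
    'M[C]_(q, n) :=
  \matrix_(j < q, i < n) 'D_(delta_mx i 0) (fun y => f y j 0) z.

(* Xf = (Xf_1, ..., Xf_q)^t, with X f_j = \sum_i X_i * df_j/dz_i. *)
Definition vf_apply n q (X : 'cV[C]_n -> 'cV[C]_n) (f : 'cV[C]_n -> 'cV[C]_q)
    (z : 'cV[C]_n) : 'cV[C]_q :=
  jacobian_mx f z *m X z.

Definition maximal_minors n q (f : 'cV[C]_n -> 'cV[C]_q) :
    set ('cV[C]_n -> C) :=
  [set m | exists2 s : 'I_q -> 'I_n, {homo s : i j / (i < j)%N} &
             m = fun z => \det (colsub s (jacobian_mx f z))].

(* The ideal generated by the germs of G in the ring of germs at p. *)
Definition germ_ideal n (p : 'cV[C]_n) (G : set ('cV[C]_n -> C)) :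
    set ('cV[C]_n -> C) :=
  [set c | exists (m : nat) (a g : 'I_m -> 'cV[C]_n -> C),
     [/\ forall k, holomorphic_at p (a k),
         forall k, G (g k) &
         \forall z \near p, c z = \sum_(k < m) a k z * g k z]].

(* The dimension at 0 of a germ of analytic set: the least d such that 0 is
   isolated in the intersection of V with the zero set of d holomorphic germs
   vanishing at 0. *)
Definition germ_cut n (V : set 'cV[C]_n) (d : nat) : Prop :=
  exists g : 'cV[C]_n -> 'cV[C]_d,
    [/\ holomorphic_mx_at 0 g, g 0 = 0 &
        \forall z \near (0 : 'cV[C]_n), V z -> g z = 0 -> z = 0].

Definition germ_dim n (V : set 'cV[C]_n) (d : nat) : Prop :=
  germ_cut V d /\ forall e, germ_cut V e -> (d <= e)%N.

(* The germ at 0 of the analytic space f = 0 has the expected dimension n - q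
   and, by the Jacobian criterion, no singular point other than 0. *)
Definition icis n q (f : 'cV[C]_n -> 'cV[C]_q) : Prop :=
  [/\ holomorphic_mx_at 0 f, f 0 = 0,
      (q <= n)%N, germ_dim [set z | f z = 0] (n - q)%N &
      \forall z \near (0 : 'cV[C]_n),
        f z = 0 -> z != 0 -> \rank (jacobian_mx f z) = q].

(* X is tangent at p to the analytic space g = 0: the vector field maps the
   ideal (g_1, ..., g_q) of germs at p to itself, i.e. Xg = Ag there. *)
Definition tangent_at n q (p : 'cV[C]_n) (X : 'cV[C]_n -> 'cV[C]_n)
    (g : 'cV[C]_n -> 'cV[C]_q) : Prop :=
  exists2 A : 'cV[C]_n -> 'M[C]_q, holomorphic_mx_at p A &
    \forall z \near p, vf_apply X g z = A z *m g z.

Definition isolated_zero_on n (V : set 'cV[C]_n) (X : 'cV[C]_n -> 'cV[C]_n) :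
    Prop :=
  X 0 = 0 /\ \forall z \near (0 : 'cV[C]_n), V z -> X z = 0 -> z = 0.

(* Xt t is the vector field X_t. One neighbourhood of 0 in C^n serves for all
   small t; on it X_t is tangent to V_t = f^-1(t) at every point of V_t. *)
Definition good_vector_field n q (f : 'cV[C]_n -> 'cV[C]_q)
    (X : 'cV[C]_n -> 'cV[C]_n) : Prop :=
  exists Xt : 'cV[C]_q -> 'cV[C]_n -> 'cV[C]_n,
    [/\ holomorphic_mx_at (0 : 'cV[C]_(n + q))
          (fun w => Xt (dsubmx w) (usubmx w)),
        \forall z \near (0 : 'cV[C]_n), Xt 0 z = X z &
        \forall t \near (0 : 'cV[C]_q) & z \near (0 : 'cV[C]_n),
          f z = t -> tangent_at z (Xt t) (fun y => f y - t)].

End Holomorphic.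

(* Main.v *)
Require Import Defs.
From HB Require Import structures.
From mathcomp Require Import all_boot all_order all_algebra.
From mathcomp Require Import complex finmap ring.
From mathcomp Require Import all_classical all_reals all_analysis.
From mathcomp.analysis.showcase Require Import summability.

(* If J is the Jacobian matrix of f, Cramer's rule writes each maximal minor m
   of J as J B = m I with B holomorphic (a cofactor matrix, padded with zero
   rows).  As the entries of C are combinations of such minors, C = J Y for a
   holomorphic n x q matrix Y, and X_t := X - Y t satisfies
   X_t (f - t) = J X - J Y t = C (f - t).
   What remains is that entries of Y are holomorphic, that is, that sums,
   products and partial derivatives of power series are power series; all of it
   rests on the equivalence of unconditional and absolute summability in the
   complex numbers. *)

Set Implicit Arguments.
Unset Strict Implicit.
Unset Printing Implicit Defensive.

Import Order.TTheory GRing.Theory Num.Theory numFieldNormedType.Exports.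

Local Open Scope ring_scope.
Local Open Scope classical_set_scope.

#[local] Existing Instance totally_filter.

(** * Unconditional sums of complex families *)

Section UnconditionalSums.
Context {R : realType}.
Local Notation C := (CC R).
Local Notation Re := (@complex.Re R).
Local Notation "x %:C" := (real_complex R x : C).

(** The mode of convergence in [power_series_at], for any index type. Convergence statements there
    are instances by unfolding. *)
Definition has_sum {I : choiceType} (F : I -> C) (l : C) : Prop :=
  partial_sum F @ totally --> l.

Lemma has_sumP (I : choiceType) (F : I -> C) (l : C) :
  has_sum F l <-> forall e, 0 < e -> exists A0 : {fset I},
    forall A, (A0 `<=` A)%fset -> `|l - \sum_(i <- A) F i| < e.
Proof.
rewrite /has_sum; split.
  move=> /cvgrPdist_lt Fl e e0; have [A0 _ HA] := Fl e e0.
  by exists A0 => A /HA; rewrite /partial_sum big_seq_fsetE.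
move=> H; apply/cvgrPdist_lt => e e0; have [A0 HA] := H e e0.
by exists A0 => // A /= /HA; rewrite /partial_sum big_seq_fsetE.
Qed.

Lemma eq_has_sum (I : choiceType) (F G : I -> C) l : F =1 G ->
  has_sum F l -> has_sum G l.
Proof. by move=> /funext ->. Qed.

Lemma has_sumD (I : choiceType) (F G : I -> C) l m :
  has_sum F l -> has_sum G m -> has_sum (fun i => F i + G i) (l + m).
Proof.
move=> Fl Gm; rewrite /has_sum.
have -> : partial_sum (fun i => F i + G i) = partial_sum F \+ partial_sum G.
  by apply/funext => A; rewrite /partial_sum /= big_split.
exact: (@cvgD C C _ totally _ _ _ _ _ Fl Gm).
Qed.

Lemma has_sumZ (I : choiceType) (F : I -> C) l (c : C) :
  has_sum F l -> has_sum (fun i => c * F i) (c * l).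
Proof.
move=> Fl; rewrite /has_sum.
have -> : partial_sum (fun i => c * F i) = (fun A => c * partial_sum F A).
  by apply/funext => A; rewrite /partial_sum /= mulr_sumr.
exact: (@cvgMl_tmp C _ totally _ _ _ _ Fl).
Qed.

Arguments has_sumZ {I F l} c _.

Lemma has_sum_finite (I : choiceType) (F : I -> C) (A : {fset I}) :
  (forall i, i \notin A -> F i = 0) -> has_sum F (\sum_(i <- A) F i).
Proof.
move=> FA; apply/has_sumP => e e0; exists A => B AB.
by rewrite -(big_fset_incl _ AB) ?subrr ?normr0// => i _ /FA.
Qed.

(** Absolute summability with an explicit constant. [has_sum_bounded] and [bounded_has_sum] make it
    equivalent to having an unconditional sum. *)
Definition bounded_sums {I : choiceType} (F : I -> C) (M : C) : Prop :=
  forall A : {fset I}, \sum_(i <- A) `|F i| <= M.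

Lemma has_sum_norm_le (I : choiceType) (F : I -> C) l M :
  has_sum F l -> bounded_sums F M -> `|l| <= M.
Proof.
move=> /has_sumP Fl FM.
have M0 : 0 <= M by have := FM fset0; rewrite big_seq_fset0.
apply/ler_addgt0Pr => e e0; have [A0 /(_ A0 (fsubset_refl _)) lA] := Fl e e0.
rewrite -[l](subrK (\sum_(i <- A0) F i)) addrC.
rewrite (le_trans (ler_normD _ _))// lerD ?(ltW lA)//.
exact: le_trans (ler_norm_sum _ _ _) (FM A0).
Qed.

(** Off some finite set [A0], finite sums are bounded by the Cauchy criterion. Summing separately
    over the terms of each sign turns this into a bound on sums of absolute values. *)
Lemma has_sum_bounded_Re (I : choiceType) (F : I -> C) l : has_sum F l ->
  exists M, forall A : {fset I}, \sum_(i <- A) `|Re (F i)| <= M.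
Proof.
move=> /has_sumP /(_ 1 ltr01)[A0 HA0].
(* The sums over [A0] and over its union with [D] both lie within 1 of [l], so they differ by at
   most 2. *)
have tail (D : {fset I}) : [disjoint A0 & D]%fset ->
    `|Re (\sum_(i <- D) F i)| <= 2.
  move=> dAD; rewrite -lecR; apply: le_trans (normc_ge_Re _) _.
  have := HA0 _ (fsubsetUl A0 D); have := HA0 _ (fsubset_refl A0).
  rewrite (big_fsetID _ (mem A0) (A0 `|` D)%fset) /=.
  have -> : [fset x in (A0 `|` D)%fset | x \in A0]%fset = A0.
    by apply/fsetP => x; rewrite !inE /= andb_orl andbb;
       case: (x \in A0); rewrite ?andbF.
  have -> : [fset x in (A0 `|` D)%fset | x \notin A0]%fset = D.
    apply/fsetP => x; rewrite !inE /=; case: (boolP (x \in A0)) => //= xA0.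
      by apply/esym/negbTE; move/fdisjointP: dAD => ->.
    by rewrite andbT.
  set a := \sum_(i <- A0) _; set d := \sum_(i <- D) _ => lt1 lt2.
  have -> : d = (l - a) - (l - (a + d)).
    by rewrite opprB addrC subrKA addrAC subrr add0r.
  rewrite (le_trans (ler_normB _ _))//= rmorphD rmorph1.
  by rewrite lerD// ltW.
(* Off [A0], the terms with nonnegative real part contribute at most 2, and so do those with
   negative real part. *)
exists (\sum_(i <- A0) `|Re (F i)| + (2 + 2)) => A.
rewrite (big_fsetID _ (mem A0)) /= lerD//.
  rewrite [leRHS](big_fsetID _ (mem A)) /=.
  have -> : [fset x in A | x \in A0]%fset = [fset x in A0 | x \in A]%fset.
    by apply/fsetP => x; rewrite !inE /= andbC.
  by rewrite lerDl sumr_ge0.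
rewrite (big_fsetID _ (fun i => 0 <= Re (F i))) /=.
set T := [fset x in A | x \notin A0]%fset.
set P := [fset x in T | 0 <= Re (F x)]%fset.
set N := [fset x in T | ~~ (0 <= Re (F x))]%fset.
have disj (D : {fset I}) : {subset D <= T} ->
    [disjoint A0 & D]%fset.
  move=> sD; apply/fdisjointP => x xA0; apply/negP => /sD.
  by rewrite !inE /= xA0 andbF.
apply: lerD.
  have -> : \sum_(i <- P) `|Re (F i)| = Re (\sum_(i <- P) F i).
    rewrite raddf_sum /= big_seq_cond [RHS]big_seq_cond.
    by apply: eq_bigr => i; rewrite andbT !inE /= => /andP[_ /ger0_norm].
  apply: le_trans (ler_norm _) (tail _ _); apply: disj => x.
  by rewrite !inE /= => /andP[].
have -> : \sum_(i <- N) `|Re (F i)| = - Re (\sum_(i <- N) F i).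
  rewrite raddf_sum /= -sumrN big_seq_cond [RHS]big_seq_cond.
  by apply: eq_bigr => i; rewrite andbT !inE /= -ltNge => /andP[_ /ltr0_norm].
apply: le_trans (ler_norm _) _.
rewrite normrN; apply: tail; apply: disj => x.
by rewrite !inE /= => /andP[].
Qed.

(** With the imaginary part written as a real part, results about [Re] cover it after scaling the
    family by [- 'i]. *)
Lemma complexReE (z : C) : z = (Re z)%:C + 'i%C * (Re (- 'i%C * z))%:C.
Proof.
by rewrite {1}[z]complexE; congr (_ + _ * _%:C); case: z => a b /=;
  rewrite !(mul0r, oppr0, mulN1r, opprK, add0r, sub0r).
Qed.

Lemma has_sum_bounded (I : choiceType) (F : I -> C) l : has_sum F l ->
  exists2 M : C, 0 < M & bounded_sums F M.
Proof.
move=> Fl; have [M HM] := has_sum_bounded_Re Fl.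
have [N HN] := has_sum_bounded_Re (has_sumZ (- 'i%C) Fl).
have M0 : 0 <= M by have := HM fset0; rewrite big_seq_fset0.
have N0 : 0 <= N by have := HN fset0; rewrite big_seq_fset0.
exists ((M + N + 1)%:C); first by rewrite ltcR ltr_wpDl// addr_ge0.
move=> A; apply: (@le_trans _ _ (\sum_(i <- A) (`|Re (F i)|%:C
    + `|Re (- 'i%C * F i)|%:C))).
  apply: ler_sum => i _; rewrite {1}(complexReE (F i)).
  rewrite (le_trans (ler_normD _ _))// normrM.
  have norm_real (x : R) : `|x%:C| = `|x|%:C.
    by rewrite normc_def /= expr0n /= addr0 sqrtr_sqr.
  have -> : `|'i%C : C| = 1.
    by rewrite normc_def /= expr0n /= add0r expr1n sqrtr1.
  by rewrite mul1r !norm_real.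
rewrite big_split /= -!rmorph_sum -rmorphD lecR.
by rewrite ler_wpDr// lerD.
Qed.

(** Finite sums of nonnegative terms increase with the index set, so they converge to their
    supremum. *)
Lemma has_sum_nonneg (I : choiceType) (g : I -> R) M : (forall i, 0 <= g i) ->
  (forall A : {fset I}, \sum_(i <- A) g i <= M) ->
  exists l : C, has_sum (fun i => (g i)%:C) l.
Proof.
move=> g0 gM; pose S := [set x | exists A : {fset I}, x = \sum_(i <- A) g i].
have supS : has_sup S.
  split; first by exists (\sum_(i <- fset0) g i); exists fset0.
  by exists M => _ [A ->].
exists (sup S)%:C; apply/has_sumP => e e0.
(* In the order on complex numbers, a positive [e] is real. *)
have [r er] : exists r, e = r%:C by exists (Re e); apply/esym/RRe_real/gtr0_real.
rewrite {}er in e0 *; move: e0; rewrite ltcR => r0.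
have [_ [A0 ->] lt_A0] := sup_adherent r0 supS.
exists A0 => A sA; rewrite -rmorph_sum -rmorphB.
have le0 : \sum_(i <- A) g i <= sup S by apply: sup_upper_bound => //; exists A.
rewrite ger0_norm ?lecR ?subr_ge0// ltcR ltrBlDr -ltrBlDl (lt_le_trans lt_A0)//.
rewrite [leRHS](big_fsetID _ (mem A0)) /=.
have -> : [fset x in A | x \in A0]%fset = A0.
  apply/fsetP => x; rewrite !inE /= andb_idl//.
  exact/fsubsetP.
by rewrite lerDl sumr_ge0.
Qed.

(** A real family [x] is the difference of the nonnegative families [|x| + x] and [|x|], whose
    finite sums are bounded. *)
Lemma bounded_has_sum_Re (I : choiceType) (F : I -> C) M : bounded_sums F M ->
  exists l : C, has_sum (fun i => (Re (F i))%:C) l.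
Proof.
move=> FM.
have bd (A : {fset I}) : \sum_(i <- A) `|Re (F i)| <= Re M.
  suff : (\sum_(i <- A) `|Re (F i)|)%:C <= M by rewrite lecE => /andP[].
  apply: le_trans (FM A); rewrite rmorph_sum; apply: ler_sum => i _.
  exact: normc_ge_Re.
have [l hl] := has_sum_nonneg (fun i => normr_ge0 (Re (F i))) bd.
have [m hm] : exists m : C, has_sum (fun i => (`|Re (F i)| + Re (F i))%:C) m.
  apply: (@has_sum_nonneg _ _ (Re M + Re M)) => [i|A].
    by rewrite -[X in _ + X]opprK subr_ge0 -normrN ler_norm.
  rewrite big_split lerD// (le_trans _ (bd A))// ler_sum// => i _.
  exact: ler_norm.
exists (m + (-1) * l).
apply: eq_has_sum (has_sumD hm (has_sumZ (-1) hl)) => i /=.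
by rewrite mulN1r rmorphD /= addrAC subrr add0r.
Qed.

Lemma bounded_has_sum (I : choiceType) (F : I -> C) M : bounded_sums F M ->
  exists l, has_sum F l.
Proof.
move=> FM; have [l hl] := bounded_has_sum_Re FM.
have [m hm] : exists m : C, has_sum (fun i => (Re (- 'i%C * F i))%:C) m.
  apply: (@bounded_has_sum_Re _ _ M) => A.
  apply: le_trans (FM A); apply: ler_sum => i _; rewrite normrM normrN.
  have -> : `|'i%C : C| = 1.
    by rewrite normc_def /= expr0n /= add0r expr1n sqrtr1.
  by rewrite mul1r.
exists (l + 'i%C * m); apply: eq_has_sum (has_sumD hl (has_sumZ 'i%C hm)) => i.
by rewrite -complexReE.
Qed.

(** The finite set [s j] lies in the fibre of [p] over [j] and contains every index of that fibre
    with a nonzero term. This one lemma serves Cauchy products, padding and shifting of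
    multi-indices. *)
Lemma has_sum_regroup (I J : choiceType) (p : I -> J) (s : J -> {fset I})
    (F : I -> C) l :
  (forall i j, i \in s j -> p i = j) ->
  (forall i, i \notin s (p i) -> F i = 0) ->
  has_sum F l -> has_sum (fun j => \sum_(i <- s j) F i) l.
Proof.
move=> sp Fs /has_sumP Fl; apply/has_sumP => e /Fl[A0 HA0].
exists [fset p i | i in A0]%fset => B AB.
rewrite -partition_disjoint_bigfcup; last first.
  move=> i j _ _ ij; apply/fdisjointP => x /sp xi; apply/negP => /sp xj.
  by rewrite -xi xj eqxx in ij.
(* Adjoining [A0] adds only zero terms: [p] maps [A0] into [B], so an index of [A0] missing from the
   union is outside its own [s (p x)]. *)
have -> : \sum_(i <- (\bigcup_(j <- B) s j)%fset) F i
        = \sum_(i <- (A0 `|` \bigcup_(j <- B) s j)%fset) F i.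
  apply: big_fset_incl; first exact: fsubsetUr.
  move=> x; rewrite inE => /orP[xA0 | -> //] xB; apply: Fs.
  apply: contra xB => xs; apply/bigfcupP; exists (p x) => //; rewrite andbT.
  by apply: (fsubsetP AB); rewrite in_imfset.
exact/HA0/fsubsetUl.
Qed.

(** Absolute summability, tested on rectangles of indices, gives a sum [S] of the product family.
    Sums over large rectangles factor, which identifies [S] with [l * m]. *)
Lemma has_sumM (I J : choiceType) (F : I -> C) (G : J -> C) l m :
  has_sum F l -> has_sum G m ->
  has_sum (fun ij : I * J => F ij.1 * G ij.2) (l * m).
Proof.
move=> Fl Gm; have [M M0 FM] := has_sum_bounded Fl.
have [N N0 GN] := has_sum_bounded Gm.
have rect (T : pzSemiRingType) (f : I -> T) (g : J -> T) (A : {fset I})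
    (B : {fset J}) : \sum_(ij <- (A `*` B)%fset) f ij.1 * g ij.2
      = (\sum_(i <- A) f i) * (\sum_(j <- B) g j).
  rewrite (perm_big [seq (i, j) | i <- A, j <- B]) /=; last first.
    apply: uniq_perm; rewrite ?fset_uniq//.
      by rewrite allpairs_uniq ?fset_uniq// => -[? ?] [? ?] _ _ [-> ->].
    move=> -[i j]; rewrite in_fsetM /=; apply/andP/allpairsP.
      by move=> [iA jB]; exists (i, j).
    by move=> [[i' j'] /= [iA jB [-> ->]]].
  rewrite big_allpairs mulr_suml.
  by apply: eq_bigr => i _; rewrite mulr_sumr.
have [S FGS] : exists S, has_sum (fun ij : I * J => F ij.1 * G ij.2) S.
  apply: (@bounded_has_sum _ _ (M * N)) => A.
  pose A1 := [fset ij.1 | ij in A]%fset; pose A2 := [fset ij.2 | ij in A]%fset.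
  have sA : (A `<=` A1 `*` A2)%fset.
    by apply/fsubsetP => ij ijA; rewrite inE !in_imfset.
  apply: (@le_trans _ _ (\sum_(ij <- (A1 `*` A2)%fset) `|F ij.1| * `|G ij.2|)).
    rewrite [leRHS](big_fsetID _ (mem A)) /=.
    have -> : [fset x in (A1 `*` A2)%fset | x \in A]%fset = A.
      apply/fsetP => x; rewrite !inE /= andb_idl// => /(fsubsetP sA).
      by rewrite inE.
    under eq_bigr do rewrite normrM.
    by rewrite lerDl sumr_ge0// => i _; rewrite mulr_ge0.
  by rewrite (rect _ (fun i => `|F i|) (fun j => `|G j|)) ler_pM// sumr_ge0.
suff -> : l * m = S by [].
(* The error [l * m - S] will split into three parts weighted by [N], [|l|] and 1. *)
have K0 : 0 < N + `|l| + 1 by rewrite ltr_wpDl// addr_ge0// ltW.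
apply/eqP; rewrite -subr_eq0 -normr_le0; apply/ler_addgt0Pr => e e0.
have d0 : 0 < e / (N + `|l| + 1) by rewrite divr_gt0.
have /has_sumP /(_ _ d0)[A0 HA] := Fl; have /has_sumP /(_ _ d0)[B0 HB] := Gm.
have /has_sumP /(_ _ d0)[T HT] := FGS.
(* Adding the projections of [T] makes the rectangle on [A] and [B] contain [T]. *)
pose A := (A0 `|` [fset ij.1 | ij in T])%fset.
pose B := (B0 `|` [fset ij.2 | ij in T])%fset.
have /HT : (T `<=` A `*` B)%fset.
  apply/fsubsetP => ij ijT; rewrite !inE.
  by rewrite !(in_imfset _ (fun ij => _ ij)) ?orbT.
move/ltW: (HA _ (fsubsetUl A0 _ : A0 `<=` A)%fset).
move/ltW: (HB _ (fsubsetUl B0 _ : B0 `<=` B)%fset).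
rewrite rect; set a := \sum_(i <- A) _; set b := \sum_(j <- B) _.
move=> leb lea /ltW leS.
have bN : `|b| <= N by exact: le_trans (ler_norm_sum _ _ _) (GN B).
have -> : l * m - S = (l - a) * b + l * (m - b) - (S - a * b) by ring.
rewrite add0r (le_trans (ler_normB _ _))//.
rewrite (le_trans (lerD (ler_normD _ _) (lexx _)))// !normrM.
have -> : e = e / (N + `|l| + 1) * N + `|l| * (e / (N + `|l| + 1))
              + e / (N + `|l| + 1).
  by rewrite [X in _ + X + _]mulrC -mulrDr -[X in _ + X]mulr1 -mulrDr mulfVK ?gt_eqF.
by rewrite lerD// lerD// ?ler_pM// ?ler_wpM2l.
Qed.

End UnconditionalSums.
Arguments has_sumZ {R I F l} c _.

(** * Power series in several variables *)

(* The bound is shaped so as to stay summable against the coefficients of a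
   power series converging at radius [|u| + d]. *)
Lemma expr_taylor1 (K : numFieldType) (u h d : K) m : 0 < d -> `|h| <= d ->
  `|(u + h) ^+ m - u ^+ m - h * (m%:R * u ^+ m.-1)|
    <= (`|h| / d) ^+ 2 * (`|u| + d) ^+ m.
Proof.
move=> d0 hd; have dn0 : d != 0 by rewrite gt_eqF.
have s0 : 0 <= `|u| + d by rewrite addr_ge0// ltW.
have hE : `|h| = `|h| / d * d by rewrite divfK.
have k0 : 0 <= `|h| / d by rewrite divr_ge0// ltW.
(* The first-order estimate, which bounds the extra term in the induction for the second-order
   one. *)
have diff1 l : `|(u + h) ^+ l - u ^+ l| <= `|h| / d * (`|u| + d) ^+ l.
  elim: l => [|l IH]; first by rewrite !expr0 subrr normr0 mulr1.
  have -> : (u + h) ^+ l.+1 - u ^+ l.+1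
      = u * ((u + h) ^+ l - u ^+ l) + h * (u + h) ^+ l
    by rewrite !exprS; move: (_ ^+ l) (_ ^+ l) => x y; ring.
  have -> : `|h| / d * (`|u| + d) ^+ l.+1
      = `|u| * (`|h| / d * (`|u| + d) ^+ l) + `|h| * (`|u| + d) ^+ l.
    by rewrite {3}hE exprS; ring.
  rewrite (le_trans (ler_normD _ _))// !normrM lerD ?ler_wpM2l//.
  rewrite normrX lerXn2r ?nnegrE//.
  by rewrite (le_trans (ler_normD _ _))// lerD2l.
elim: m => [|m IH].
  by rewrite !expr0 mul0r mulr0 subr0 subrr normr0 mulr1 exprn_ge0.
have -> : (u + h) ^+ m.+1 - u ^+ m.+1 - h * (m.+1%:R * u ^+ m.+1.-1)
    = u * ((u + h) ^+ m - u ^+ m - h * (m%:R * u ^+ m.-1))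
      + h * ((u + h) ^+ m - u ^+ m).
  rewrite !exprS /= -[m.+1]addn1 natrD (mulrDl m%:R) mul1r.
  have -> : m%:R * u ^+ m = u * (m%:R * u ^+ m.-1).
    by case: (m) => [|k]; rewrite ?mul0r ?mulr0// exprS /=; ring.
  by move: (m%:R * _) ((u + h) ^+ m) (u ^+ m) => x y z; ring.
have -> : (`|h| / d) ^+ 2 * (`|u| + d) ^+ m.+1
    = `|u| * ((`|h| / d) ^+ 2 * (`|u| + d) ^+ m)
      + `|h| * (`|h| / d * (`|u| + d) ^+ m).
  by rewrite {3}hE !exprS; ring.
by rewrite (le_trans (ler_normD _ _))// !normrM lerD// ler_wpM2l.
Qed.

(** Cauchy's estimate for the derivative of a monomial; it makes the termwise derivative of a power
    series summable. *)
Lemma expr_cauchy1 (K : numFieldType) (u d : K) m : 0 < d ->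
  `|m%:R * u ^+ m.-1| <= d^-1 * (`|u| + d) ^+ m.
Proof.
move=> d0; have dn0 : d != 0 by rewrite gt_eqF.
have s0 : 0 <= `|u| + d by rewrite addr_ge0// ltW.
elim: m => [|m IH]; first by rewrite mul0r normr0 mulr1 invr_ge0 ltW.
have -> : m.+1%:R * u ^+ m.+1.-1 = u * (m%:R * u ^+ m.-1) + u ^+ m.
  rewrite /= -[m.+1]addn1 natrD mulrDl mul1r; congr (_ + _).
  by case: (m) => [|k]; rewrite ?mul0r ?mulr0// exprS /=; ring.
have -> : d^-1 * (`|u| + d) ^+ m.+1
    = `|u| * (d^-1 * (`|u| + d) ^+ m) + (`|u| + d) ^+ m.
  by rewrite exprS mulrDl mulrDr mulKf// mulrCA.
rewrite (le_trans (ler_normD _ _))// lerD//; first by rewrite normrM ler_wpM2l.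
by rewrite normrX lerXn2r ?nnegrE// lerDl ltW.
Qed.

Section PowerSeries.
Context {R : realType}.
Local Notation C := (CC R).
Local Notation midx n := {ffun 'I_n -> nat}.

Lemma nbhs_cVP n (p : 'cV[C]_n) (P : set 'cV[C]_n) :
  (\forall z \near p, P z) <->
  exists2 r : C, 0 < r & forall z : 'cV[C]_n, (forall k, `|p k 0 - z k 0| < r) -> P z.
Proof.
split.
  move=> /nbhs_ballP[r r0 rP]; exists r => // z zr; apply: rP; split=> //.
  by move=> i j; rewrite ord1; exact: zr.
move=> [r r0 rP]; apply/nbhs_ballP; exists r => // z [_ zr].
by apply: rP => k; exact: zr.
Qed.

Lemma multi_powerD n (h : 'cV[C]_n) (al be : midx n) :
  multi_power h [ffun i => (al i + be i)%N] = multi_power h al * multi_power h be.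
Proof.
by rewrite /multi_power -big_split; apply: eq_bigr => i _; rewrite ffunE exprD.
Qed.

Lemma power_series_cst n (p : 'cV[C]_n) (c : C) :
  power_series_at p (fun=> c).
Proof.
pose o : midx n := [ffun=> 0%N].
exists (fun al => if al == o then c else 0); apply: filterE => z.
have := @has_sum_finite _ _ (fun al => (if al == o then c else 0)
  * multi_power (z - p) al) [fset o]%fset.
rewrite big_seq_fset1 eqxx /multi_power big1 ?mulr1; last first.
  by move=> i _; rewrite ffunE expr0.
by apply=> al; rewrite inE => /negbTE ->; rewrite mul0r.
Qed.

Lemma power_seriesD n (p : 'cV[C]_n) (f g : 'cV[C]_n -> C) :
  power_series_at p f -> power_series_at p g ->
  power_series_at p (fun z => f z + g z).
Proof.
move=> [a fa] [b gb]; exists (fun al => a al + b al).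
apply: filterS2 fa gb => z fa gb; have := has_sumD fa gb.
by apply: eq_has_sum => al; rewrite mulrDl.
Qed.

Lemma power_series_coord n (p : 'cV[C]_n) (i : 'I_n) :
  power_series_at p (fun z => z i 0).
Proof.
suff : power_series_at p (fun z => z i 0 - p i 0).
  move=> /power_seriesD/(_ (power_series_cst p (p i 0))).
  by under [X in power_series_at p X]funext do rewrite subrK.
pose e : midx n := [ffun j => (j == i : nat)].
exists (fun al => (al == e)%:R); apply: filterE => z.
have := @has_sum_finite _ _ (fun al => (al == e)%:R
  * multi_power (z - p) al) [fset e]%fset.
rewrite big_seq_fset1 eqxx mul1r /multi_power (bigD1 i)//= big1 ?mulr1.
  rewrite ffunE eqxx expr1 !mxE.
  by apply=> al; rewrite inE => /negbTE ->; rewrite mul0r.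
by move=> j /negbTE ji; rewrite ffunE ji expr0.
Qed.

(** The fibre of addition of multi-indices over [c]. Components of a summand are at most the total
    degree of [c], so candidates can be enumerated by a finite type. *)
Definition midx_splits n (c : midx n) : {fset midx n * midx n} :=
  [fset ab | ab in
     [seq ([ffun i => u.1 i : nat], [ffun i => u.2 i : nat]) |
        u : {ffun 'I_n -> 'I_(\sum_j c j).+1} * {ffun 'I_n -> 'I_(\sum_j c j).+1}]
   & [ffun i => (ab.1 i + ab.2 i)%N] == c]%fset.

Lemma mem_midx_splits n (a b c : midx n) :
  ((a, b) \in midx_splits c) = ([ffun i => (a i + b i)%N] == c).
Proof.
rewrite !inE /= andb_idl// => /eqP abc.
have le_c (i : 'I_n) : (c i < (\sum_j c j).+1)%N.
  by rewrite ltnS (bigD1 i)//= leq_addr.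
have ca (i : 'I_n) : (a i < (\sum_j c j).+1)%N.
  by apply: leq_ltn_trans (le_c i); rewrite -abc ffunE leq_addr.
have cb (i : 'I_n) : (b i < (\sum_j c j).+1)%N.
  by apply: leq_ltn_trans (le_c i); rewrite -abc ffunE leq_addl.
apply/fintype.imageP.
exists ([ffun i => Ordinal (ca i)], [ffun i => Ordinal (cb i)]) => //.
by congr pair; apply/ffunP => i; rewrite !ffunE.
Qed.

(** The Cauchy product: the family of products of terms is regrouped along addition of
    multi-indices. *)
Lemma power_seriesM n (p : 'cV[C]_n) (f g : 'cV[C]_n -> C) :
  power_series_at p f -> power_series_at p g ->
  power_series_at p (fun z => f z * g z).
Proof.
move=> [a fa] [b gb].
exists (fun c => \sum_(ab <- midx_splits c) a ab.1 * b ab.2).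
apply: filterS2 fa gb => z fa gb; have := has_sumM fa gb.
move=> /(@has_sum_regroup R (midx n * midx n)%type (midx n)
  (fun ab => [ffun i => (ab.1 i + ab.2 i)%N]) (@midx_splits n)) sfg.
apply: eq_has_sum (sfg _ _) => [c|[u v] c|[u v]] /=.
- rewrite mulr_suml big_seq_cond [RHS]big_seq_cond; apply: eq_bigr => -[u v].
  by rewrite andbT mem_midx_splits => /eqP <- /=; rewrite multi_powerD mulrACA.
- by rewrite mem_midx_splits => /eqP.
- by rewrite mem_midx_splits eqxx.
Qed.

Lemma near_usubmx n q (w : 'cV[C]_(n + q)) (P : set 'cV[C]_n) :
  (\forall z \near usubmx w, P z) -> \forall v \near w, P (usubmx v).
Proof.
move=> /nbhs_cVP[r r0 rP]; apply/nbhs_cVP; exists r => // v vr.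
by apply: rP => k; rewrite !mxE.
Qed.

Lemma power_series_usubmx n q (w : 'cV[C]_(n + q)) (g : 'cV[C]_n -> C) :
  power_series_at (usubmx w) g ->
  power_series_at w (fun v : 'cV[C]_(n + q) => g (usubmx v)).
Proof.
move=> [a /near_usubmx ga].
pose low (c : midx (n + q)) : midx n := [ffun i => c (lshift q i)].
pose ext (c : midx n) : midx (n + q) :=
  [ffun k => if fintype.split k is inl i then c i else 0%N].
(* The test [ext (low c) == c] says that the monomial involves none of the last [q] variables. *)
exists (fun c => if ext (low c) == c then a (low c) else 0).
apply: filterS ga => v ga.
have low_ext (c : midx n) : low (ext c) = c.
  by apply/ffunP => i; rewrite !ffunE (unsplitK (inl i)).
have := @has_sum_regroup R (midx n) (midx (n + q)) ext
  (fun c => if ext (low c) == c then [fset low c]%fset else fset0) _ _ _ _ ga.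
move=> sg; apply: eq_has_sum (sg _ _) => [c|i c|i].
- case: eqP => [<-|_]; last by rewrite big_seq_fset0 mul0r.
  rewrite low_ext big_seq_fset1; congr (_ * _).
  rewrite /multi_power big_split_ord /= [X in _ * X]big1 ?mulr1.
    apply: eq_bigr => i _; rewrite !ffunE !mxE.
    by rewrite (unsplitK (inl i)) ffunE.
  by move=> i _; rewrite ffunE (unsplitK (inr i)) expr0.
- by case: eqP => [<-|//]; rewrite inE low_ext => /eqP ->.
- by rewrite low_ext eqxx inE eqxx.
Qed.

(** After division by [h], the quadratic remainder is at most [|h| M], so the difference quotient
    tends to [g]. *)
Lemma derive_taylor1 n (f : 'cV[C]_n -> C) (z v : 'cV[C]_n) (g d M : C) :
  0 < d -> 0 < M ->
  (forall h, `|h| <= d -> `|f (h *: v + z) - f z - h * g| <= `|h| ^+ 2 * M) ->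
  'D_v f z = g.
Proof.
move=> d0 M0 fE; apply: (@cvg_lim C (@norm_hausdorff C C)).
apply/(@cvgrPdist_le C C) => e e0; near=> h.
have h0 : h != 0 by near: h; exact: nbhs_dnbhs_neq.
rewrite /= distrC.
have -> : h^-1 *: (f (h *: v + z) - f z) - g
        = h^-1 * (f (h *: v + z) - f z - h * g).
  by rewrite mulrBr mulKf.
rewrite normrM normfV ler_pdivrMl ?normr_gt0// (le_trans (fE h _))//.
  near: h; exact: dnbhs0_le.
rewrite expr2 -mulrA ler_wpM2l// -ler_pdivlMr//.
near: h; apply: dnbhs0_le; exact: divr_gt0.
Unshelve. all: by end_near. Qed.

(** Termwise differentiation: the derived series and the Taylor remainders are all dominated by the
    series of absolute values at polyradius [rho]. *)
Lemma power_series_derive n (p : 'cV[C]_n) (f : 'cV[C]_n -> C) (i : 'I_n) :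
  power_series_at p f -> power_series_at p ('D_(delta_mx i 0) f).
Proof.
move=> [a /nbhs_cVP[r r0 fa]].
(* A point within [d] of [p], moved by at most [d] along a coordinate, stays within [rho = r / 2] of
   [p], inside the region of convergence. *)
pose d := r / 4%:R; pose rho := d + d.
have d0 : 0 < d by rewrite divr_gt0// ltr0n.
have rho_r : rho < r.
  rewrite /rho /d -mulrDl ltr_pdivrMr ?ltr0n// -[r + r]mulr2n -[r *+ 2]mulr_natr.
  by rewrite ltr_pM2l// ltr_nat.
have rho0 : 0 <= rho by rewrite addr_ge0// ltW.
pose mrho (al : midx n) : C := multi_power (const_mx rho) al.
have cE k : (const_mx rho : 'cV[C]_n) k 0 = rho by rewrite mxE.
have mrho0 al : 0 <= mrho al.
  by apply: prodr_ge0 => k _; rewrite mxE exprn_ge0.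
have [M M0 aM] : exists2 M : C, 0 < M & bounded_sums (fun al => a al * mrho al) M.
  have /fa /has_sum_bounded : forall k, `|p k 0 - (const_mx rho + p) k 0| < r.
    by move=> k; rewrite !mxE opprD addrCA subrr addr0 normrN ger0_norm.
  by rewrite addrK.
pose succ (be : midx n) : midx n := [ffun k => (be k + (k == i))%N].
exists (fun be : midx n => (be i).+1%:R * a (succ be)).
apply/nbhs_cVP; exists d => // z zd; pose u := z - p.
have u_le k : `|u k 0| <= d by rewrite !mxE distrC ltW.
(* [P al] is the monomial without its [i]-th factor, and [D] is the termwise derivative, indexed by
   the exponents before differentiation. *)
pose P (al : midx n) := \prod_(k | k != i) u k 0 ^+ al k.
pose D (al : midx n) := a al * ((al i)%:R * u i 0 ^+ (al i).-1 * P al).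
have P_le (al : midx n) (x : C) c : 0 <= c ->
    `|x| <= c * (`|u i 0| + d) ^+ al i ->
    `|a al * (x * P al)| <= c * `|a al * mrho al|.
  move=> c0 xc; rewrite !normrM [c * _]mulrCA ler_wpM2l//.
  rewrite (ger0_norm (mrho0 al)) /mrho /multi_power (bigD1 i)//= mulrA.
  rewrite normr_prod ler_pM// ?prodr_ge0//.
    rewrite (le_trans xc)// ler_wpM2l// cE lerXn2r ?nnegrE//.
      by rewrite addr_ge0// ltW.
    by rewrite /rho lerD2r.
  apply: ler_prod => k _; rewrite normr_ge0 /= normrX cE lerXn2r ?nnegrE//.
  by rewrite (le_trans (u_le k))// lerDl ltW.
have bounded_le (F : midx n -> C) c : 0 <= c ->
    (forall al, `|F al| <= c * `|a al * mrho al|) -> bounded_sums F (c * M).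
  move=> c0 FaM A; apply: le_trans (ler_wpM2l c0 (aM A)).
  by rewrite mulr_sumr ler_sum.
have [g sD] : exists g, has_sum D g.
  apply: (@bounded_has_sum _ _ _ (d^-1 * M)); apply: bounded_le => [|al].
    by rewrite invr_ge0 ltW.
  by apply: P_le; [rewrite invr_ge0 ltW | exact: expr_cauchy1].
have -> : 'D_(delta_mx i 0) f z = g.
  have M'0 : 0 < (d ^- 2) * M by rewrite mulr_gt0// invr_gt0 exprn_gt0.
  apply: (derive_taylor1 d0 M'0) => h hd.
  set z' := h *: _ + z.
  have z'E k : (z' - p) k 0 = if k == i then u i 0 + h else u k 0.
    rewrite !mxE eqxx andbT; case: eqP => [->|_].
      by rewrite mulr1 -addrA addrC.
    by rewrite mulr0 add0r.
  have z'r k : `|p k 0 - z' k 0| < r.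
    have -> : p k 0 - z' k 0 = - (z' - p) k 0 by rewrite !mxE opprB.
    rewrite normrN z'E (le_lt_trans _ rho_r)//.
    case: eqP => _; last by rewrite (le_trans (u_le k))// lerDl ltW.
    by rewrite (le_trans (ler_normD _ _))// lerD.
  have zr k : `|p k 0 - z k 0| < r.
    by rewrite (lt_trans (zd k))// (le_lt_trans _ rho_r)// lerDl ltW.
  (* The Taylor remainder of [f] is the sum of the remainders of its monomials, each controlled by
     [expr_taylor1]. *)
  have := has_sumD (has_sumD (fa z' z'r) (has_sumZ (-1) (fa z zr)))
    (has_sumZ (- h) sD).
  rewrite mulN1r mulNr mulrA -exprVn -exprMn => /has_sum_norm_le; apply.
  apply: bounded_le => [|al]; first by rewrite exprn_ge0// divr_ge0// ltW.
  have z'P : multi_power (z' - p) al = (u i 0 + h) ^+ al i * P al.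
    rewrite /multi_power (bigD1 i)//= z'E eqxx; congr (_ * _).
    by apply: eq_bigr => k /negbTE ki; rewrite z'E ki.
  have zP : multi_power (z - p) al = u i 0 ^+ al i * P al.
    by rewrite /multi_power (bigD1 i).
  rewrite z'P zP.
  have -> : a al * ((u i 0 + h) ^+ al i * P al) + -1 * (a al * (u i 0 ^+ al i * P al))
      + - h * D al
    = a al * (((u i 0 + h) ^+ al i - u i 0 ^+ al i
        - h * ((al i)%:R * u i 0 ^+ (al i).-1)) * P al).
    by rewrite /D; move: (_ * _ ^+ _.-1) (_ ^+ _) (_ ^+ _) => x y t; ring.
  by apply: P_le; [rewrite exprn_ge0// divr_ge0// ltW | exact: expr_taylor1].
(* Reindexing by [succ]. Truncated subtraction fails to invert [succ] only where [al i = 0], and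
   there the factor [(al i)%:R] kills the term of [D]. *)
have := @has_sum_regroup R (midx n) (midx n)
  (fun al : midx n => [ffun k => (al k - (k == i))%N])
  (fun be : midx n => [fset succ be]%fset) D g.
move=> sg; apply: eq_has_sum (sg _ _ sD) => [be|al be|al].
- rewrite big_seq_fset1 /D ffunE eqxx addn1 /= mulrA [a _ * _]mulrC -mulrA.
  have -> : P (succ be) = P be.
    by apply: eq_bigr => k /negbTE ki; rewrite ffunE ki addn0.
  rewrite /multi_power [in RHS](bigD1 i)//= -!mulrA; congr (_ * _).
  by rewrite mulrCA.
- rewrite inE => /eqP ->; apply/ffunP => k; rewrite !ffunE.
  by rewrite addnK.
- rewrite inE => al_neq; rewrite /D; have [->|ali] := posnP (al i).
    by rewrite !mul0r mulr0.
  case/eqP: al_neq; apply/ffunP => k; rewrite !ffunE subnK//.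
  by case: eqP => [->|].
Qed.

End PowerSeries.

(** * Holomorphic germs *)

Section HolomorphicGerms.
Context {R : realType}.
Local Notation C := (CC R).

Lemma holomorphic_at_cst n (p : 'cV[C]_n) (c : C) : holomorphic_at p (fun=> c).
Proof. by apply: filterE => w; exact: power_series_cst. Qed.

Lemma holomorphic_at_coord n (p : 'cV[C]_n) i : holomorphic_at p (fun z => z i 0).
Proof. by apply: filterE => w; exact: power_series_coord. Qed.

Lemma holomorphic_atD n (p : 'cV[C]_n) (f g : 'cV[C]_n -> C) :
  holomorphic_at p f -> holomorphic_at p g ->
  holomorphic_at p (fun z => f z + g z).
Proof. by apply: filterS2 => w; exact: power_seriesD. Qed.

Lemma holomorphic_atM n (p : 'cV[C]_n) (f g : 'cV[C]_n -> C) :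
  holomorphic_at p f -> holomorphic_at p g ->
  holomorphic_at p (fun z => f z * g z).
Proof. by apply: filterS2 => w; exact: power_seriesM. Qed.

Lemma holomorphic_at_derive n (p : 'cV[C]_n) (f : 'cV[C]_n -> C) i :
  holomorphic_at p f -> holomorphic_at p ('D_(delta_mx i 0) f).
Proof. by apply: filterS => w; exact: power_series_derive. Qed.

Lemma holomorphic_at_usubmx n q (w : 'cV[C]_(n + q)) (g : 'cV[C]_n -> C) :
  holomorphic_at (usubmx w) g ->
  holomorphic_at w (fun v : 'cV[C]_(n + q) => g (usubmx v)).
Proof.
by move=> /near_usubmx; apply: filterS => v; exact: power_series_usubmx.
Qed.

Lemma holomorphic_at_sum n (p : 'cV[C]_n) (I : Type) (r : seq I) (P : pred I)
    (f : I -> 'cV[C]_n -> C) : (forall i, holomorphic_at p (f i)) ->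
  holomorphic_at p (fun z => \sum_(i <- r | P i) f i z).
Proof.
move=> fh; elim: r => [|i r IH].
  by under eq_fun do rewrite big_nil; exact: holomorphic_at_cst.
under eq_fun do rewrite big_cons.
case: (P i); last exact: IH.
exact: (holomorphic_atD (fh i) IH).
Qed.

Lemma holomorphic_at_prod n (p : 'cV[C]_n) (I : Type) (r : seq I) (P : pred I)
    (f : I -> 'cV[C]_n -> C) : (forall i, holomorphic_at p (f i)) ->
  holomorphic_at p (fun z => \prod_(i <- r | P i) f i z).
Proof.
move=> fh; elim: r => [|i r IH].
  by under eq_fun do rewrite big_nil; exact: holomorphic_at_cst.
under eq_fun do rewrite big_cons.
case: (P i); last exact: IH.
exact: (holomorphic_atM (fh i) IH).
Qed.

Lemma holomorphic_at_det n (p : 'cV[C]_n) k (A : 'cV[C]_n -> 'M[C]_k) :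
  holomorphic_mx_at p A -> holomorphic_at p (fun z => \det (A z)).
Proof.
move=> hA; apply: holomorphic_at_sum => s.
apply: holomorphic_atM; first exact: holomorphic_at_cst.
by apply: holomorphic_at_prod.
Qed.

Lemma holomorphic_mx_at_cst n (p : 'cV[C]_n) k l (A : 'M[C]_(k, l)) :
  holomorphic_mx_at p (fun=> A).
Proof. by move=> i j; exact: holomorphic_at_cst. Qed.

Lemma holomorphic_mx_atM n (p : 'cV[C]_n) k l m (A : 'cV[C]_n -> 'M[C]_(k, l))
    (B : 'cV[C]_n -> 'M[C]_(l, m)) :
  holomorphic_mx_at p A -> holomorphic_mx_at p B ->
  holomorphic_mx_at p (fun z => A z *m B z).
Proof.
move=> hA hB i j; under eq_fun do rewrite mxE.
by apply: holomorphic_at_sum => t; exact: holomorphic_atM.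
Qed.

Lemma holomorphic_mx_at_sum n (p : 'cV[C]_n) k l (I : Type) (r : seq I)
    (A : I -> 'cV[C]_n -> 'M[C]_(k, l)) :
  (forall t, holomorphic_mx_at p (A t)) ->
  holomorphic_mx_at p (fun z => \sum_(t <- r) A t z).
Proof.
move=> hA i j; under eq_fun do rewrite summxE.
by apply: holomorphic_at_sum => t; exact: hA.
Qed.

Lemma holomorphic_mx_at_adj n (p : 'cV[C]_n) k (A : 'cV[C]_n -> 'M[C]_k) :
  holomorphic_mx_at p A -> holomorphic_mx_at p (fun z => \adj (A z)).
Proof.
move=> hA i j; under eq_fun do rewrite mxE.
apply: holomorphic_atM; first exact: holomorphic_at_cst.
apply: holomorphic_at_det => s t; under eq_fun do rewrite !mxE.
exact: hA.
Qed.

Lemma holomorphic_jacobian n q (p : 'cV[C]_n) (f : 'cV[C]_n -> 'cV[C]_q) :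
  holomorphic_mx_at p f -> holomorphic_mx_at p (jacobian_mx f).
Proof.
move=> hf i j; under eq_fun do rewrite mxE.
exact: holomorphic_at_derive.
Qed.

(* For a maximal minor [\det (J E)], where [E] selects columns of [J], Cramer's
   rule gives [J (E \adj (J E)) = \det (J E)%:M]. *)
Lemma minors_ideal_factor n q (p : 'cV[C]_n) (f : 'cV[C]_n -> 'cV[C]_q)
    (c : 'cV[C]_n -> C) :
  holomorphic_mx_at p f -> germ_ideal p (maximal_minors f) c ->
  exists Y : 'cV[C]_n -> 'M[C]_(n, q), holomorphic_mx_at p Y /\
    \forall z \near p, jacobian_mx f z *m Y z = (c z)%:M.
Proof.
move=> hf [m [a [g [ha gm hc]]]].
have /choice[s gE] : forall k, exists s : 'I_q -> 'I_n,
    g k = fun z => \det (colsub s (jacobian_mx f z)).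
  by move=> k; have [s _ ->] := gm k; exists s.
exists (fun z => \sum_(k < m)
  a k z *: (colsub (s k) 1%:M *m \adj (colsub (s k) (jacobian_mx f z)))); split.
  apply: holomorphic_mx_at_sum => k i j; under eq_fun do rewrite mxE.
  apply: holomorphic_atM; first exact: ha.
  apply: holomorphic_mx_atM; first exact: holomorphic_mx_at_cst.
  apply: holomorphic_mx_at_adj => u v; under eq_fun do rewrite mxE.
  exact: holomorphic_jacobian.
apply: filterS hc => z ->; rewrite mulmx_sumr raddf_sum /=.
apply: eq_bigr => k _; rewrite gE -scalemxAr mulmxA mulmx_colsub mulmx1.
by rewrite mul_mx_adj scale_scalar_mx.
Qed.

(** Multiplying the factorization of each scalar matrix [(A z i j)%:M] on the right by the matrix
    unit [delta_mx i j] and summing recovers [A]. *)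
Lemma matrix_minors_ideal_factor n q (p : 'cV[C]_n) (f : 'cV[C]_n -> 'cV[C]_q)
    k (A : 'cV[C]_n -> 'M[C]_(q, k)) :
  holomorphic_mx_at p f ->
  (forall i j, germ_ideal p (maximal_minors f) (fun z => A z i j)) ->
  exists Y : 'cV[C]_n -> 'M[C]_(n, k), holomorphic_mx_at p Y /\
    \forall z \near p, jacobian_mx f z *m Y z = A z.
Proof.
move=> hf hA.
have [Y YP] := choice (fun ij : 'I_q * 'I_k =>
  minors_ideal_factor hf (hA ij.1 ij.2)).
exists (fun z => \sum_(i < q) \sum_(j < k) Y (i, j) z *m delta_mx i j); split.
  apply: holomorphic_mx_at_sum => i; apply: holomorphic_mx_at_sum => j.
  apply: holomorphic_mx_atM; last exact: holomorphic_mx_at_cst.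
  by case: (YP (i, j)).
have /filter_forall : forall ij, \forall z \near p,
    jacobian_mx f z *m Y ij z = (A z ij.1 ij.2)%:M by move=> ij; case: (YP ij).
apply: filterS => z JY; rewrite [RHS]matrix_sum_delta mulmx_sumr.
apply: eq_bigr => i _; rewrite mulmx_sumr; apply: eq_bigr => j _.
by rewrite mulmxA JY mul_scalar_mx.
Qed.

(** The constant [t] cancels already in the difference quotients. *)
Lemma jacobian_mxB n q (f : 'cV[C]_n -> 'cV[C]_q) (t : 'cV[C]_q) :
  jacobian_mx (fun y => f y - t) = jacobian_mx f.
Proof.
apply/funext => z; apply/matrixP => j i; rewrite [LHS]mxE [RHS]mxE.
have -> : (fun y => (f y - t) j 0) = (fun y => f y j 0 - t j 0).
  by apply/funext => y; rewrite !mxE.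
rewrite /derive.
set v : 'cV[C]_n := delta_mx i 0.
set F := (fun h : C => _); set G := (fun h : C => _).
have -> // : F = G.
by apply/funext => h; rewrite /F /G /= opprB addrA subrK.
Qed.

End HolomorphicGerms.

(** * The deformation [X - Y t] and its tangency to the fibres *)

Theorem proposition4p1 (R : realType) (n q : nat)
    (f : 'cV[CC R]_n -> 'cV[CC R]_q)
    (X : 'cV[CC R]_n -> 'cV[CC R]_n)
    (C : 'cV[CC R]_n -> 'M[CC R]_q)
    (hf : icis f)
    (hX : holomorphic_mx_at 0 X)
    (hC : holomorphic_mx_at 0 C)
    (hXf : \forall z \near (0 : 'cV[CC R]_n), vf_apply X f z = C z *m f z)
    (hX0 : isolated_zero_on [set z | f z = 0] X)
    (hCI : forall i j, germ_ideal 0 (maximal_minors f) (fun z => C z i j)) :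
  good_vector_field f X.
Proof.
have [f_holo _ _ _ _] := hf.
have [Y [Y_holo JY]] := matrix_minors_ideal_factor f_holo hCI.
exists (fun t z => X z - Y z *m t); split.
- have u0 : usubmx (0 : 'cV[CC R]_(n + q)) = 0 by rewrite linear0.
  move=> i j; rewrite ord1.
  (* Each entry is affine in [t], with coefficients pulled back from the first [n] variables; the
     components of [t] are the last [q] coordinates of [w]. *)
  have -> : (fun w : 'cV[CC R]_(n + q) => (X (usubmx w) - Y (usubmx w) *m dsubmx w) i 0)
      = (fun w => X (usubmx w) i 0
           + (-1) * \sum_k Y (usubmx w) i k * w (rshift n k) 0).
    apply/funext => w; rewrite !mxE mulN1r; congr (_ - _).
    by apply: eq_bigr => k _; rewrite !mxE.
  apply: holomorphic_atD.
    by apply: (@holomorphic_at_usubmx _ _ _ _ (fun z => X z i 0)); rewrite u0.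
  apply: holomorphic_atM; first exact: holomorphic_at_cst.
  apply: holomorphic_at_sum => k; apply: holomorphic_atM.
    by apply: (@holomorphic_at_usubmx _ _ _ _ (fun z => Y z i k)); rewrite u0.
  exact: holomorphic_at_coord.
- by apply: filterE => z; rewrite mulmx0 subr0.
(* Tangency at [z] concerns germs at [z], so the data at 0 are first spread to all nearby points by
   [near_join]. The matrix [C] then serves every [t], on a neighbourhood independent of [t]. *)
- have tangent : \forall z \near (0 : 'cV[CC R]_n), forall t,
      tangent_at z (fun z => X z - Y z *m t) (fun y => f y - t).
    have C_holo : \forall z \near (0 : 'cV[CC R]_n), holomorphic_mx_at z C.
      have C_ij i j : \forall z \near (0 : 'cV[CC R]_n),
          holomorphic_at z (fun y => C y i j) := near_join (hC i j).
      exact: (filter_forall _ (fun i => filter_forall _ (C_ij i))).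
    have JX := near_join hXf.
    move/near_join in JY.
    apply: filterS3 C_holo JX JY => z Cz JX JY t; exists C => //.
    apply: filterS2 JX JY => y; rewrite /vf_apply jacobian_mxB => JX JY.
    by rewrite !mulmxBr JX mulmxA JY.
  exists (setT, [set z | forall t,
    tangent_at z (fun z => X z - Y z *m t) (fun y => f y - t)]).
    by split=> //; exact: filterT.
  by move=> [t z] [_ /(_ t)].
Qed.
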